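(* Let $k,r,n\in\mathbb{N}$ with $0<k<\frac n2$ be such that $\gcd(k,n)=1$ and $k^r\equiv 1 \pmod n$. Then the generalized Petersen graph $G(n,k)$ is an induced subgraph of a minimal Cayley graph of the semidirect product $$C_n\rtimes C_r=\langle a,b\mid a^r=b^n=e,\ aba^{-1}=b^k\rangle .$$
   Context: For integers $k,n$ with $0<k<\frac n2$, the generalized Petersen graph $G(n,k)$ is the graph on the $2n$ vertices $u_0,\dots,u_{n-1},v_0,\dots,v_{n-1}$ with edges $u_iu_{i+1}$, $v_iv_{i+k}$ and $u_iv_i$ for $0\le i\le n-1$, all subscripts taken modulo $n$. For a finite group $\Gamma$ and a subset $S\subseteq\Gamma$, the (undirected, right) Cayley graph $\mathrm{Cay}(\Gamma,S)$ has vertex set $\Gamma$, and $g,h\in\Gamma$ form an edge if $g^{-1}h\in S$ or $h^{-1}g\in S$ (the graph is regarded as undirected even if $S$ is not inverse-closed). It is called minimal if $S$ is an inclusion-minimal generating set of $\Gamma$, i.e. $S$ generates $\Gamma$ and no proper subset of $S$ does. ''Is an induced subgraph of'' means ''is isomorphic to an induced subgraph of''. $C_m$ denotes the cyclic group of order $m$. The semidirect product $C_n\rtimes C_r$ is the one in which a generator $a$ of $C_r$ acts on $C_n=\langle b\rangle$ by $b\mapsto b^k$.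
   Formalization: The formal theorem assumes r > 1: for r = 1 the hypotheses force k = 1 and the group is C_n with n elements, too few for the 2n vertices of G(n,1), so the claim is false; for r = 0 there is no cyclic group of order r. *)

(* Defs.v *)
From mathcomp Require Import all_boot all_fingroup all_algebra all_solvable.

Set Implicit Arguments.
Unset Strict Implicit.
Unset Printing Implicit Defensive.

Import GroupScope.

(* [inl i] is the outer vertex u_i and [inr i] the inner vertex v_i. *)
Definition petersen_vertex (n : nat) : finType := ('I_n + 'I_n)%type.

Definition petersen (n k : nat) : rel (petersen_vertex n) := fun x y =>
  match x, y with
  | inl i, inl j => (j == i + 1 %[mod n]) || (i == j + 1 %[mod n])
  | inr i, inr j => (j == i + k %[mod n]) || (i == j + k %[mod n])
  | inl i, inr j | inr i, inl j => i == j
  end.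
Arguments petersen : clear implicits.

Definition cayley (gT : finGroupType) (S : {set gT}) : rel gT :=
  fun g h => (g^-1 * h \in S) || (h^-1 * g \in S).

Definition minimal_generating (gT : finGroupType) (S : {set gT}) : bool :=
  minset (fun T : {set gT} => <<T>> == [set: gT]) S.

(* An isomorphism of the graph [e] onto the subgraph of [e'] induced on the
   image of [f]. *)
Definition induced_subgraph (V W : finType) (e : rel V) (e' : rel W) : Prop :=
  exists2 f : V -> W, injective f & forall x y, e' (f x) (f y) = e x y.

(* [Extremal.gtype n r k] is MathComp's external semidirect product of 'Z_n by
   'Z_r in which 1 : 'Z_r acts by the automorphism x |-> x ^+ k of 'Z_n.  It
   has this meaning only if 1 < n, 1 < r and that automorphism exists and has
   order dividing r, which [semidirect_aut] derives from the hypotheses on n, r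
   and k.  Since MathComp's conjugation is x ^ y = y^-1 * x * y, the generator a
   with a * b * a^-1 = b ^+ k is the inverse of MathComp's generator. *)
Definition semidirect (n r k : nat) : finGroupType := Extremal.gtype n r k.

Lemma semidirect_aut n r k :
  1 < n -> coprime k n -> k ^ r = 1 %[mod n] ->
  exists s, [/\ s \in Aut <[Zp1 : 'Z_n]>, #[s] %| r & s Zp1 = Zp1 ^+ k].
Proof.
move=> n_gt1 co_kn kr1; set b := Zp1.
have ob: #[b] = n by rewrite order_Zp1 Zp_cast.
have uk: (k%:R : 'Z_#[b])%R \in GRing.unit by rewrite unitZpE ob // coprime_sym.
exists (Zp_unitm (FinRing.unit 'Z_#[b] uk)).
rewrite Aut_aut order_injm ?injm_Zp_unitm ?in_setT //; split=> //.
  rewrite order_dvdn -val_eqE FinRing.val_unitX /= -GRing.natrX.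
  by rewrite -val_eqE /= val_Zp_nat ob // kr1 Zp_cast // modn_small.
apply/eqP; rewrite autE ?cycle_id // eq_expg_mod_order /=.
by rewrite val_Zp_nat ob // modn_mod.
Qed.

Lemma semidirect_presentation n r k :
  1 < n -> 1 < r -> coprime k n -> k ^ r = 1 %[mod n] ->
  [set: semidirect n r k]
    \isog Grp (a : b : a ^+ r, b ^+ n, a * b * a^-1 = b ^+ k).
Proof.
move=> n_gt1 r_gt1 co_kn kr1.
have isoG := Extremal.Grp r_gt1 n_gt1 (semidirect_aut n_gt1 co_kn kr1).
move=> gT G; rewrite isoG; apply/existsP/existsP=> [] [[x y]] /=.
  case/eqP=> <- xn1 yr1 xy; exists (y^-1, x).
  by rewrite !xpair_eqE /= cycleV joingC expgVn yr1 invg1 xn1 invgK -mulgA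
             -/(conjg x y) xy !eqxx.
case/eqP=> <- yr1 xn1 yx; exists (y, x^-1).
by rewrite !xpair_eqE /= cycleV joingC expgVn yr1 invg1 xn1 /conjg invgK mulgA
           yx !eqxx.
Qed.

Lemma semidirect_sdprod n r k :
  1 < n -> 1 < r -> coprime k n -> k ^ r = 1 %[mod n] ->
  exists a b : semidirect n r k,
    [/\ <[b]> ><| <[a]> = [set: semidirect n r k], #[b] = n, #[a] = r
      & a * b * a^-1 = b ^+ k].
Proof.
move=> n_gt1 r_gt1 co_kn kr1.
have /existsP[[a b] /=] :=
  isoGrp_hom (semidirect_presentation n_gt1 r_gt1 co_kn kr1).
case/eqP=> defG ar1 bn1 ab; exists a, b.
have nBA: <[a]> \subset 'N(<[b]>).
  rewrite -cycleV norms_cycle /conjg invgK mulgA ab mem_cycle //.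
have oG := Extremal.card k r_gt1 n_gt1.
have dvd_a: #[a] %| r by rewrite order_dvdn ar1.
have dvd_b: #[b] %| n by rewrite order_dvdn bn1.
have le_a := dvdn_leq (ltnW r_gt1) dvd_a.
have le_b := dvdn_leq (ltnW n_gt1) dvd_b.
have oBA := mul_cardG <[b]> <[a]>.
rewrite -norm_joinEr // joingC [<[a]> <*> _]defG oG -!orderE in oBA.
have I_gt0 := cardG_gt0 (<[b]> :&: <[a]>).
have rn_le: r * n <= #[b] * #[a] by rewrite oBA leq_pmulr.
have oa: #[a] = r.
  apply/eqP; rewrite eqn_leq le_a -(leq_pmul2l (ltnW n_gt1)) mulnC.
  by rewrite (leq_trans rn_le) // leq_mul2r le_b orbT.
have ob: #[b] = n.
  apply/eqP; rewrite eqn_leq le_b -(leq_pmul2r (ltnW r_gt1)) mulnC.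
  by rewrite (leq_trans rn_le) // leq_mul2l le_a orbT.
split=> //; rewrite sdprodE -?norm_joinEr // 1?joingC //.
apply/card1_trivg/eqP; rewrite -(eqn_pmul2l (ltnW n_gt1)).
by rewrite -(eqn_pmul2l (ltnW r_gt1)) muln1 mulnA -oBA oa ob mulnC.
Qed.

(* Main.v *)
(** With [S = {a, b}], right multiplication by [b] sends [b^i] to [b^(i+1)] and,
    since [a b = b^k a], sends [b^i a] to [b^(i+k) a]; right multiplication by
    [a] sends [b^i] to [b^i a].  Hence the cosets [<b>] and [<b>a] induce
    [G(n,k)] in the Cayley graph, with [u_i = b^i] and [v_i = b^i a]. *)
Require Import Defs.
From mathcomp Require Import all_boot all_fingroup all_algebra all_solvable.

Set Implicit Arguments.
Unset Strict Implicit.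
Unset Printing Implicit Defensive.

Import GroupScope.

(** A generating subset of [{a, b}] that omits one of the two elements would lie in the cyclic group
    of the other, which does not contain the omitted one. *)
Lemma minimal_generating_pair (gT : finGroupType) (a b : gT) :
    <[b]> * <[a]> = [set: gT] -> a \notin <[b]> -> b \notin <[a]> ->
  minimal_generating [set a; b].
Proof.
move=> defG aNb bNa; apply/minsetP; split=> [|B /eqP genB sBS].
  rewrite -subTset -defG mul_subG // cycle_subG mem_gen // !inE eqxx ?orbT //.
apply/eqP; rewrite eqEsubset sBS subUset !sub1set.
have cycleB x y : x \notin <[y]> -> {subset B <= [set x; y]} -> x \in B.
  move=> xNy sB; apply: contraR xNy => xNB.
  have: x \in <<B>> by rewrite genB inE.
  apply: subsetP; rewrite gen_subG; apply/subsetP=> z zB.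
  have := sB z zB; rewrite !inE => /orP[/eqP zx | /eqP->]; last exact: cycle_id.
  by rewrite -zx zB in xNB.
rewrite (cycleB a b) ?(cycleB b a) //; first by rewrite setUC; apply/subsetP.
exact/subsetP.
Qed.

(** Right multiplication by [b] preserves each of the two cosets, while right multiplication by [a]
    moves every element out of its coset. So only [b] gives edges inside a coset and only [a] gives
    edges between them. *)
Lemma petersen_induced_cayley (gT : finGroupType) (a b : gT) (n k : nat) :
    #[b] = n -> <[b]> :&: <[a]> = 1 -> a \notin <[b]> -> a * b = b ^+ k * a ->
  induced_subgraph (petersen n k) (cayley [set a; b]).
Proof.
move=> ob tiBA aNb ab.
have bX i : b ^+ i \in <[b]> by exact: mem_cycle.
have eqX i j : (b ^+ i == b ^+ j) = (i == j %[mod n]).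
  by rewrite eq_expg_mod_order ob.
have eqXo (i j : 'I_n) : (b ^+ i == b ^+ j) = (i == j).
  by rewrite eqX !modn_small.
have mulXab i : b ^+ i * a * b = b ^+ (i + k) * a.
  by rewrite -mulgA ab mulgA expgD.
have eqVM (x y z : gT) : (x^-1 * y == z) = (y == x * z).
  by rewrite -(inj_eq (mulgI x)) mulKVg.
have neqXa i j : (b ^+ i == b ^+ j * a) = false.
  by apply: contraNF aNb; rewrite -eqVM => /eqP<-; rewrite groupM ?groupV.
have neqaX i j : (b ^+ i * a == b ^+ j) = false by rewrite eq_sym neqXa.
(* [a] may have order 2, and then the arc from [b^j a] along [a] ends in [b^j]. *)
have eqXaa i j : b ^+ i == b ^+ j * a * a -> b ^+ j == b ^+ i.
  rewrite -mulgA -eqVM => /eqP eq_aa.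
  have: a * a \in <[b]> :&: <[a]>.
    by rewrite inE -{1}eq_aa !groupM ?groupV ?cycle_id.
  by rewrite tiBA -eq_aa inE eqVM mulg1 eq_sym.
pose f (x : petersen_vertex n) :=
  match x with inl i => b ^+ i | inr i => b ^+ i * a end.
exists f => [[i|i] [j|j] /eqP|[i|i] [j|j]];
    rewrite /cayley /= ?inE ?eqVM ?(inj_eq (mulIg a)).
(* The first four cases are the injectivity of [f], the last four compare adjacencies. *)
- by rewrite eqXo => /eqP->.
- by rewrite neqXa.
- by rewrite neqaX.
- by rewrite eqXo => /eqP->.
- by rewrite !neqXa -!expgSr !eqX !addn1.
(* Two disjuncts survive: the spoke, and the arc along [a] from [v_j] to [u_i], which forces [i = j]
   and so is absorbed. *)
- rewrite -expgSr mulXab neqaX neqXa !orbF [RHS]eq_sym -eqXo.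
  by apply: orb_idr => /eqXaa.
- rewrite -expgSr mulXab neqaX neqXa !orbF -eqXo.
  by apply: orb_idl => /eqXaa.
- by rewrite !mulXab !neqXa !(inj_eq (mulIg a)) !eqX.
Qed.

Theorem theorem5p1 (k r n : nat) (k_gt0 : 0 < k) (k_lt : k.*2 < n)
    (r_gt1 : 1 < r) (co_kn : coprime k n) (kr1 : k ^ r = 1 %[mod n]) :
  exists2 S : {set semidirect n r k},
    minimal_generating S & induced_subgraph (petersen n k) (cayley S).
Proof.
have n_gt1 : 1 < n by rewrite (leq_ltn_trans _ k_lt) // double_gt0.
have [a [b [/sdprodP[_ defG _ tiBA] ob oa ab]]] :=
  semidirect_sdprod n_gt1 r_gt1 co_kn kr1.
(* A generator lying in both factors would be trivial, but the orders [r] and [n] exceed 1. *)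
have aNb : a \notin <[b]>.
  apply: contraTN r_gt1 => a_b; rewrite -oa -leqNgt.
  have : a \in <[b]> :&: <[a]> by rewrite inE a_b cycle_id.
  by rewrite tiBA => /set1P->; rewrite order1.
have bNa : b \notin <[a]>.
  apply: contraTN n_gt1 => b_a; rewrite -ob -leqNgt.
  have : b \in <[b]> :&: <[a]> by rewrite inE b_a cycle_id.
  by rewrite tiBA => /set1P->; rewrite order1.
exists [set a; b]; first exact: minimal_generating_pair.
by apply: petersen_induced_cayley => //; rewrite -ab mulgKV.
Qed.
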